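(* Let $l\in\{1,\ldots,NT\}$, $L=\{1,\ldots,l\}$, and let $S_j\subseteq L$ for each $j\in J$. Then for every $i\in I$ the $(l,S_j)$-inequality $$\sum_{j=1}^{NJ}\Big(\sum_{u\in L\setminus S_j}x^{ij}_u+\sum_{u\in S_j}y^j_u\,d^i_{ul}\Big)\ge d^i_{1l}$$ is valid for the multi-item inventory lot-sizing problem with supplier selection, i.e. it is satisfied by every feasible solution $(x,y)$ of the standard formulation of that problem.
   Context: Data: items $I=\{1,\ldots,NI\}$, suppliers $J=\{1,\ldots,NJ\}$, periods $T=\{1,\ldots,NT\}$, demands $d^i_t\ge 0$ for $i\in I$, $t\in T$; $d^i_{kt}=\sum_{l=k}^td^i_l$ for $k\le t$ is the cumulative demand. The feasible solutions $(x,y)$ of the standard formulation are those satisfying $\sum_{j=1}^{NJ}\sum_{k=1}^tx^{ij}_k\ge d^i_{1t}$ for $i\in I$, $t\in T$; $x^{ij}_t\le My^j_t$ for $i\in I$, $j\in J$, $t\in T$; $y^j_t\in\{0,1\}$ for $j\in J$, $t\in T$; $x^{ij}_t\ge 0$ for $i\in I$, $j\in J$, $t\in T$, where $M$ is a sufficiently large positive constant. Here $x^{ij}_t$ is the amount of item $i$ purchased from supplier $j$ in period $t$, and $y^j_t$ indicates whether purchases are made from supplier $j$ in period $t$. *)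

(* Defs.v *)
(* The real numbers are generalized to an arbitrary realFieldType. *)
From mathcomp Require Import all_boot all_order all_algebra.

Set Implicit Arguments.
Unset Strict Implicit.
Unset Printing Implicit Defensive.

Import Order.TTheory GRing.Theory Num.Theory.
Local Open Scope ring_scope.

(* Items, suppliers and periods are 'I_NI, 'I_NJ and 'I_NT, hence numbered
   from 0: period t of the usual numbering 1, ..., NT is the ordinal t - 1. *)

(* d^i_{kt}; the bounds are zero-based, so d^i_{1t} is [cumdem d i 0 t]. *)
Definition cumdem (R : realFieldType) (NI NT : nat) (d : 'I_NI -> 'I_NT -> R)
    (i : 'I_NI) (k t : nat) : R :=
  \sum_(s < NT | (k <= s <= t)%N) d i s.

Record feasible (R : realFieldType) (NI NJ NT : nat)
    (d : 'I_NI -> 'I_NT -> R) (M : R)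
    (x : 'I_NI -> 'I_NJ -> 'I_NT -> R) (y : 'I_NJ -> 'I_NT -> R) : Prop :=
  Feasible {
    feasible_demand : forall (i : 'I_NI) (t : 'I_NT),
      \sum_(j < NJ) \sum_(k < NT | (k <= t)%N) x i j k >= cumdem d i 0 t;
    feasible_setup : forall (i : 'I_NI) (j : 'I_NJ) (t : 'I_NT),
      x i j t <= M * y j t;
    feasible_binary : forall (j : 'I_NJ) (t : 'I_NT), y j t = 0 \/ y j t = 1;
    feasible_nonneg : forall (i : 'I_NI) (j : 'I_NJ) (t : 'I_NT), 0 <= x i j t
  }.

(* L = {1, ..., l} in the one-based numbering. *)
Definition periods_upto (NT : nat) (l : 'I_NT) : {set 'I_NT} :=
  [set u : 'I_NT | (u <= l)%N].

Definition lS_inequality (R : realFieldType) (NI NJ NT : nat)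
    (d : 'I_NI -> 'I_NT -> R) (l : 'I_NT) (S : 'I_NJ -> {set 'I_NT})
    (i : 'I_NI) (x : 'I_NI -> 'I_NJ -> 'I_NT -> R) (y : 'I_NJ -> 'I_NT -> R) :
    Prop :=
  \sum_(j < NJ) (\sum_(u in periods_upto l :\: S j) x i j u
                 + \sum_(u in S j) y j u * cumdem d i u l)
    >= cumdem d i 0 l.

Definition valid (R : realFieldType) (NI NJ NT : nat)
    (d : 'I_NI -> 'I_NT -> R) (M : R)
    (ineq : ('I_NI -> 'I_NJ -> 'I_NT -> R) -> ('I_NJ -> 'I_NT -> R) -> Prop) :
    Prop :=
  forall x y, feasible d M x y -> ineq x y.

(* Main.v *)
(* Let k be the first period at which some supplier j with k in S_j is used
   (k = l + 1 if there is none).  Before k the setup constraints force x = 0 on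
   every S_j, so the demand d_{1,k-1} is bought in the periods of L \ S_j; the
   term y^j_k d_{kl} = d_{kl} covers the remaining demand. *)
Require Import Defs.
From mathcomp Require Import all_boot all_order all_algebra.

Set Implicit Arguments.
Unset Strict Implicit.
Unset Printing Implicit Defensive.

Import Order.TTheory GRing.Theory Num.Theory.
Local Open Scope ring_scope.

Lemma cumdem_ge0 (R : realFieldType) (NI NT : nat)
    (d : 'I_NI -> 'I_NT -> R) (hd : forall i t, 0 <= d i t) i k t :
  0 <= cumdem d i k t.
Proof. exact: sumr_ge0. Qed.

(** The bound [k <= t.+1] puts every period before [k] among those up to [t]; at [k = t.+1] the last
    term is an empty sum. *)
Lemma cumdem_split (R : realFieldType) (NI NT : nat)
    (d : 'I_NI -> 'I_NT -> R) i (k t : nat) : (k <= t.+1)%N ->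
  cumdem d i 0 t = \sum_(s < NT | (s < k)%N) d i s + cumdem d i k t.
Proof.
move=> le_kt; rewrite /cumdem (bigID (fun s : 'I_NT => (s < k)%N)) /=.
congr (_ + _); apply: eq_bigl => s; last by rewrite -leqNgt andbC.
by case: ltnP => [lt_sk|]; rewrite ?andbF // andbT -ltnS (leq_trans lt_sk).
Qed.

(** A binary [y j t] other than 1 is 0, so the setup constraint bounds [x i j t] above by
    [M * 0]. *)
Lemma feasible_inactive (R : realFieldType) (NI NJ NT : nat)
    (d : 'I_NI -> 'I_NT -> R) (M : R) x (y : 'I_NJ -> 'I_NT -> R) i j t :
  feasible d M x y -> y j t != 1 -> x i j t = 0.
Proof.
move=> [_ setup bin xge0] y1; apply/le_anti; rewrite xge0 andbT.
have := setup i j t; case: (bin j t) y1 => ->; last by rewrite eqxx.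
by rewrite mulr0.
Qed.

(** The demand constraint of period [k - 1] is compared term by term with the right side: purchases
    before [k] in [S j] vanish, and the periods from [k] on only add nonnegative terms. *)
Lemma demand_before_setup (R : realFieldType) (NI NJ NT : nat)
    (d : 'I_NI -> 'I_NT -> R) (M : R) x (y : 'I_NJ -> 'I_NT -> R)
    (l : 'I_NT) (S : 'I_NJ -> {set 'I_NT}) i (k : nat) :
  feasible d M x y -> (k <= l.+1)%N ->
  (forall j u, u \in S j -> (u < k)%N -> y j u != 1) ->
  \sum_(s < NT | (s < k)%N) d i s
    <= \sum_(j < NJ) \sum_(u in periods_upto l :\: S j) x i j u.
Proof.
move=> fxy le_kl y1; have xge0 := feasible_nonneg fxy.
(* At [k = 0] there is no period [k - 1], but the demand sum is empty. *)
case: k le_kl y1 => [|k] lt_kl y1.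
  by rewrite big_pred0 // !sumr_ge0 // => j _; rewrite sumr_ge0.
have lt_kNT : (k < NT)%N by apply: leq_ltn_trans (ltn_ord l).
have := feasible_demand fxy i (Ordinal lt_kNT); rewrite /cumdem /= => dem.
apply: le_trans dem _; apply: ler_sum => j _.
rewrite big_mkcond [leRHS]big_mkcond; apply: ler_sum => u _ /=.
rewrite !inE; case: (leqP u k) => [le_uk|_]; last by case: ifP.
rewrite (leq_trans le_uk lt_kl) andbT; case: ifPn => // /negbNE uS.
by rewrite (feasible_inactive i fxy (y1 j u uS _)).
Qed.

Theorem theorem3 (R : realFieldType) (NI NJ NT : nat)
    (d : 'I_NI -> 'I_NT -> R) (hd : forall i t, 0 <= d i t)
    (M : R) (hM : 0 < M)
    (l : 'I_NT) (S : 'I_NJ -> {set 'I_NT})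
    (hS : forall j, S j \subset periods_upto l) (i : 'I_NI) :
  valid d M (lS_inequality d l S i).
Proof.
move=> x y fxy; rewrite /lS_inequality big_split /=.
have yd_ge0 j u : 0 <= y j u * cumdem d i u l.
  by rewrite mulr_ge0 ?cumdem_ge0 //; case: (feasible_binary fxy j u) => ->.
pose active k := [exists j, [exists u in S j, (u == k :> nat) && (y j u == 1)]].
(* The sentinel [l.+1] ensures that a minimum exists. *)
have exk : exists k, (k == l.+1) || active k by exists l.+1; rewrite eqxx.
case: (ex_minnP exk) => k Pk k_min.
have le_kl : (k <= l.+1)%N by apply: k_min; rewrite eqxx.
rewrite (cumdem_split d i le_kl); apply: lerD.
  (* By minimality of [k], a [u] in [S j] with [y j u = 1] satisfies [k <= u]. *)
  apply: demand_before_setup fxy le_kl _ => j u uS; apply: contraTneq => yju.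
  rewrite -leqNgt; apply: k_min; apply/orP; right; apply/existsP; exists j.
  by apply/existsP; exists u; rewrite uS yju !eqxx.
have sum_ge0 j : 0 <= \sum_(u in S j) y j u * cumdem d i u l.
  exact: sumr_ge0.
case/orP: Pk => [/eqP-> | /existsP[j /existsP[u /and3P[uS /eqP<- /eqP yju]]]].
  (* At [k = l.+1] no demand remains to be covered. *)
  rewrite [leLHS]big_pred0 ?sumr_ge0 // => s.
  by apply/negbTE; rewrite negb_and -!ltnNge ltnS leqNgt orbC orbN.
(* The term of [j] and [u], where [u] is period [k], is exactly the remaining demand; all other
   terms are nonnegative. *)
rewrite (bigD1 j) //= (bigD1 u) //= yju mul1r -addrA lerDl.
by rewrite addr_ge0 ?sumr_ge0.
Qed.
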